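(* Let $m\ge 1$ be an integer, let $a_0\ge 0$, $a>0$, $b>0$, $C_0>0$, $L\ge 0$, $M>0$, and put $$\bar\Gamma=\{(x,Y):\ x\in[a_0,a_0+a],\ Y\in\mathbb{R}^m,\ |Y|_2\le b+C_0\}.$$ Let $\mathcal F$ be a class of functions $f:\bar\Gamma\to\mathbb{R}$ such that every $f\in\mathcal F$ is continuous on $\bar\Gamma$, satisfies $\max_{(x,Y)\in\bar\Gamma}|f(x,Y)|\le M$, and satisfies the Lipschitz condition $|f(x,Y)-f(x,\tilde Y)|\le L|Y-\tilde Y|_2$ for all $(x,Y),(x,\tilde Y)\in\bar\Gamma$. Let $\alpha=\min\{a,b/M\}$. Consider the ODE $$y^{(m)}(x)=f\big(x,y(x),y'(x),\dots,y^{(m-1)}(x)\big),\qquad (y(a_0),y'(a_0),\dots,y^{(m-1)}(a_0))=Y_0,$$ and assume that for every $f\in\mathcal F$ and every $Y_0\in\mathbb{R}^m$ with $|Y_0|_2\le C_0$ it has a solution on $[a_0,a_0+\alpha]$ with $(x,Y(x))\in\bar\Gamma$ for all $x\in[a_0,a_0+\alpha]$, where $Y(x)=(y(x),y'(x),\dots,y^{(m-1)}(x))$. Let $\mathcal Y_0$ be the class of all such solutions $y$ on $[a_0,a_0+\alpha]$ (with $f$ ranging over $\mathcal F$ and $Y_0$ over $\{|Y_0|_2\le C_0\}$), and for $0\le k\le m-1$ let $\mathcal Y_k=\{y^{(k)}:y\in\mathcal Y_0\}$. Define $$L_{\max}=\sup_{x\in[a_0,a_0+\alpha]}\Big\{\exp\big(x\sqrt{L^2+1}\big)\Big[1+\int_0^x\exp\big(-s\sqrt{L^2+1}\big)ds\Big]\Big\}.$$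 Then for every $\delta>0$ and every $k\in\{0,\dots,m-1\}$, $$\log N_\infty(\delta,\mathcal Y_k)\le \log N_\infty\Big(\frac{\delta}{L_{\max}},\mathcal F\Big)+m\log\Big(\frac{2C_0L_{\max}}{\delta}+1\Big),$$ where $N_\infty(\cdot,\mathcal F)$ is taken with respect to the supremum metric on $\bar\Gamma$ and $N_\infty(\cdot,\mathcal Y_k)$ with respect to the supremum metric on $[a_0,a_0+\alpha]$.
   Context: Covering number: for a set $\mathbb T$ with metric $\rho$, a set $\{t^1,\dots,t^N\}\subset\mathbb T$ is a $\delta$-cover if every $t\in\mathbb T$ has some $i$ with $\rho(t,t^i)\le\delta$; $N_\rho(\delta;\mathbb T)$ is the smallest cardinality of a $\delta$-cover. $N_\infty$ denotes the covering number with respect to the supremum metric $|f-g|_\infty=\sup|f-g|$ over the relevant domain. $|\cdot|_2$ is the Euclidean norm. *)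

(* Defs.v *)
From HB Require Import structures.
From mathcomp Require Import all_boot all_order all_algebra.
From mathcomp Require Import all_classical all_reals all_analysis.
Unset Printing Implicit Defensive.
Import Order.TTheory GRing.Theory Num.Theory.
Import numFieldNormedType.Exports.
Local Open Scope classical_set_scope.
Local Open Scope ring_scope.

Section Defs.
Context {R : realType}.

Definition enorm (m : nat) (Y : 'rV[R]_m) : R := Num.sqrt (\sum_(i < m) Y 0 i ^+ 2).

Definition Gammabar (m : nat) (a0 a b C0 : R) : set (R * 'rV[R]_m) :=
  [set p : R * 'rV[R]_m | a0 <= p.1 <= a0 + a /\ enorm m p.2 <= b + C0].

Definition cinterval (lo hi : R) : set R := [set x | lo <= x <= hi].

Definition supdist {T : Type} (D : set T) (f g : T -> R) : \bar R :=
  ereal_sup [set (`|f x - g x|)%:E | x in D].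

(* Covering number N_infty(delta; A) w.r.t. the sup metric on D: the smallest
   cardinality of a delta-cover {t^1,...,t^n} included in A (+oo if none). *)
Definition covnum {T : Type} (D : set T) (delta : R) (A : set (T -> R)) : \bar R :=
  ereal_inf [set (n%:R)%:E | n in
    [set n : nat | exists c : nat -> (T -> R),
       (forall i, (i < n)%N -> A (c i)) /\
       (forall t, A t -> exists i, (i < n)%N /\ (supdist D t (c i) <= delta%:E)%E)]].

(* g is the derivative of h on the set I (one-sided at boundary points):
   for x in I, (h(x+t) - h x)/t -> g x as t -> 0 with t <> 0, x + t in I. *)
Definition deriv_on (I : set R) (h g : R -> R) : Prop :=
  forall x, I x ->
    (fun t => t^-1 * (h (x + t) - h x)) @ within [set t | t != 0 /\ I (x + t)] (nbhs (0 : R))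
      --> g x.

(* Y(x) = (y(x), y'(x), ..., y^(m-1)(x)) where ys k stands for y^(k). *)
Definition Yvec {m : nat} (ys : nat -> R -> R) (x : R) : 'rV[R]_m :=
  \row_(i < m) ys i x.

Definition is_solution (m : nat) (a0 a b C0 al : R) (f : R * 'rV[R]_m -> R)
    (Y0 : 'rV[R]_m) (ys : nat -> R -> R) : Prop :=
  let I := cinterval a0 (a0 + al) in
  (forall k, (k < m)%N -> deriv_on I (ys k) (ys k.+1)) /\
  (forall x, I x -> ys m x = f (x, Yvec ys x)) /\
  Yvec ys a0 = Y0 /\
  (forall x, I x -> Gammabar m a0 a b C0 (x, Yvec ys x)).

Definition Ycls (m : nat) (a0 a b C0 al : R) (F : set (R * 'rV[R]_m -> R)) (k : nat)
  : set (R -> R) :=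
  [set g | exists f Y0 ys, F f /\ enorm m Y0 <= C0 /\
           is_solution m a0 a b C0 al f Y0 ys /\ g = ys k].

Definition Lmax (L a0 al : R) : R :=
  let c := Num.sqrt (L ^+ 2 + 1) in
  sup [set expR (x * c) *
           (1 + Rintegral lebesgue_measure (cinterval 0 x) (fun s => expR (- (s * c))))
      | x in cinterval a0 (a0 + al)].

End Defs.

(* Main.v *)
(** A solution of the ODE is stable under perturbing both the right-hand side
    and the initial value by at most [e]: the difference [Z] of the two curves
    satisfies [|Z'| <= sqrt (L^2 + 1) |Z| + e], so Gronwall's inequality gives
    [|Z| <= e Lmax].  With [e = delta / Lmax], the solutions attached to an
    [e]-cover of [F] and an [e]-cover of the ball of radius [C0] therefore form
    a [delta]-cover of [Y_k].

    The ball has an [e]-cover of cardinality at most [(2 C0 / e + 1)^m], namely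
    a maximal [e]-separated family.  Instead of comparing volumes, its
    cardinality is bounded by a self-similarity argument: iterating the family
    inside itself [k] times turns a crude counting bound into
    [N^k <= K ((2 C0 / e + 1)^m)^k] with [K] independent of [k]. *)
Require Import Defs.
From HB Require Import structures.
From mathcomp Require Import all_boot all_order all_algebra.
From mathcomp Require Import all_classical all_reals all_analysis.
From mathcomp Require Import ring lra.
Import Order.TTheory GRing.Theory Num.Theory.
Import numFieldNormedType.Exports.
Local Open Scope classical_set_scope.
Local Open Scope ring_scope.

Set Implicit Arguments.
Unset Strict Implicit.

(** * Cauchy-Schwarz and the Euclidean norm on row vectors *)

Lemma cauchy_schwarz (R : realType) (m : nat) (u v : 'I_m -> R) :
  \sum_i u i * v i <= Num.sqrt (\sum_i u i ^+ 2) * Num.sqrt (\sum_i v i ^+ 2).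
Proof.
set A := \sum_i u i ^+ 2; set B := \sum_i v i ^+ 2; set P := \sum_i u i * v i.
have A0 : 0 <= A by apply: sumr_ge0 => i _; exact: sqr_ge0.
have B0 : 0 <= B by apply: sumr_ge0 => i _; exact: sqr_ge0.
suff PAB : P ^+ 2 <= A * B.
  rewrite -sqrtrM//; apply: le_trans (ler_norm P) _.
  by rewrite -sqrtr_sqr ler_sqrt// mulr_ge0.
(* Lagrange's identity; the sum over ordered pairs counts each pair twice, hence the factor 2. *)
have lagrange : \sum_i \sum_j (u i * v j - u j * v i) ^+ 2 = 2 * (A * B - P ^+ 2).
  have -> : 2 * (A * B - P ^+ 2) = A * B + B * A - 2 * (P * P) by ring.
  rewrite /A /B /P !big_distrlr /= mulr_sumr -big_split -sumrB /=.
  apply: eq_bigr => i _; rewrite mulr_sumr -big_split -sumrB /=.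
  by apply: eq_bigr => j _; ring.
have : 0 <= 2 * (A * B - P ^+ 2).
  by rewrite -lagrange; apply: sumr_ge0 => i _; apply: sumr_ge0 => j _; exact: sqr_ge0.
lra.
Qed.

Section EuclideanNorm.
Context {R : realType} {m : nat}.
Implicit Types Y Z : 'rV[R]_m.

Lemma enorm_ge0 Y : 0 <= enorm m Y. Proof. exact: sqrtr_ge0. Qed.

Lemma sum_sqr_ge0 Y : 0 <= \sum_(i < m) Y 0 i ^+ 2.
Proof. by apply: sumr_ge0 => i _; exact: sqr_ge0. Qed.

Lemma sqr_enorm Y : enorm m Y ^+ 2 = \sum_(i < m) Y 0 i ^+ 2.
Proof. by rewrite sqr_sqrtr// sum_sqr_ge0. Qed.

Lemma enorm0 : enorm m 0 = 0 :> R.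
Proof. by rewrite /enorm big1 ?sqrtr0// => i _; rewrite mxE expr0n. Qed.

Lemma enormZ (q : R) Y : enorm m (q *: Y) = `|q| * enorm m Y.
Proof.
rewrite /enorm -sqrtr_sqr -sqrtrM ?sqr_ge0// mulr_sumr; congr Num.sqrt.
by apply: eq_bigr => i _; rewrite mxE exprMn.
Qed.

Lemma enormN Y : enorm m (- Y) = enorm m Y.
Proof. by rewrite -scaleN1r enormZ normrN1 mul1r. Qed.

Lemma enorm_distC Y Z : enorm m (Y - Z) = enorm m (Z - Y).
Proof. by rewrite -enormN opprB. Qed.

Lemma ler_enormD Y Z : enorm m (Y + Z) <= enorm m Y + enorm m Z.
Proof.
rewrite -(@ler_pXn2r _ 2) ?nnegrE ?addr_ge0 ?enorm_ge0//.
have -> : enorm m (Y + Z) ^+ 2 =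
    enorm m Y ^+ 2 + enorm m Z ^+ 2 + 2 * \sum_(i < m) Y 0 i * Z 0 i.
  rewrite !sqr_enorm mulr_sumr -!big_split /=.
  by apply: eq_bigr => i _; rewrite mxE; ring.
have := @cauchy_schwarz R m (Y 0) (Z 0).
rewrite -/(enorm m Y) -/(enorm m Z); nra.
Qed.

Lemma ler_enormB Y Z : enorm m (Y - Z) <= enorm m Y + enorm m Z.
Proof. by rewrite -(enormN Z) ler_enormD. Qed.

Lemma ler_coord_enorm Y (i : 'I_m) : `|Y 0 i| <= enorm m Y.
Proof.
rewrite -sqrtr_sqr ler_sqrt ?sum_sqr_ge0// (bigD1 i)//= lerDl.
by apply: sumr_ge0 => j _; exact: sqr_ge0.
Qed.

(** The squares add up to less than [m * (d / m)^2 = d^2 / m <= d^2]. The positivity of [d] is read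
    off from the bound on the first coordinate. *)
Lemma enorm_lt (d : R) Y : (0 < m)%N ->
  (forall i, `|Y 0 i| < d / m%:R) -> enorm m Y < d.
Proof.
move=> m0 Yd; have m1 : 1 <= m%:R :> R by rewrite ler1n.
have dm0 : 0 < d / m%:R by apply: le_lt_trans (Yd (Ordinal m0)).
have d0 : 0 < d by move: dm0; rewrite pmulr_lgt0// invr_gt0; lra.
rewrite -(@ltr_pXn2r _ 2) ?nnegrE ?enorm_ge0 ?ltW// sqr_enorm.
apply: (@lt_le_trans _ _ (\sum_(i < m) (d / m%:R) ^+ 2)).
  apply: ltr_sum => [|i _]; first by apply/hasP; exists (Ordinal m0); rewrite ?mem_index_enum.
  by rewrite -(real_normK (num_real (Y 0 i))) ltr_pXn2r// ?nnegrE ltW.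
rewrite sumr_const card_ord.
have -> : (d / m%:R) ^+ 2 *+ m = d ^+ 2 / m%:R.
  by rewrite -[LHS]mulr_natl; field; rewrite gt_eqF//; lra.
by rewrite ler_pdivrMr ?ler_peMr ?sqr_ge0//; lra.
Qed.

End EuclideanNorm.

(** * Separated families and covers of a Euclidean ball *)

Section BallCovering.
Context {R : realType} {m : nat} (m_gt0 : (0 < m)%N).

(* Half-open grid cells of side d / m contain no two points at distance d, so
   each holds at most one point of a d-separated family. *)
Lemma card_separated_grid (T : finType) (p : T -> 'rV[R]_m) (B d : R) :
  0 < d -> 0 <= B -> (forall t, enorm m (p t) <= B) ->
  (forall t u, t != u -> d <= enorm m (p t - p u)) ->
  #|T|%:R <= (2 * B * m%:R / d + 1) ^+ m.
Proof.
move=> d0 B0 pB psep.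
have mR : 0 < m%:R :> R by rewrite ltr0n.
set K := Num.truncn (2 * B * m%:R / d).
pose cell t i := (p t 0 i + B) / (d / m%:R).
have dm0 : 0 < d / m%:R by rewrite divr_gt0.
have cell_ge0 t i : 0 <= cell t i.
  rewrite divr_ge0 ?(ltW dm0)//; move: (le_trans (ler_coord_enorm (p t) i) (pB t)).
  by rewrite ler_norml; lra.
have cellK t i : (Num.truncn (cell t i) < K.+1)%N.
  rewrite ltnS /K; apply: le_truncn.
  have -> : 2 * B * m%:R / d = (2 * B) / (d / m%:R) by field; rewrite !gt_eqF.
  rewrite ler_pM2r ?invr_gt0//; move: (le_trans (ler_coord_enorm (p t) i) (pB t)).
  by rewrite ler_norml; lra.
pose code t := [ffun i : 'I_m => Ordinal (cellK t i)].
have code_inj : injective code.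
  move=> t u tu; apply/eqP; apply: contraT => /psep; rewrite leNgt => /negP[].
  apply: enorm_lt => // i.
  have : code t i = code u i by rewrite tu.
  rewrite !ffunE => /(congr1 val)/= tui.
  have := truncn_itv (cell_ge0 t i); have := truncn_itv (cell_ge0 u i).
  rewrite tui -natr1 => /andP[u1 u2] /andP[t1 t2].
  have : `|cell t i - cell u i| < 1 by rewrite ltr_norml; lra.
  rewrite /cell -mulrBl opprD addrACA subrr addr0 normrM normfV (gtr0_norm dm0).
  by rewrite ltr_pdivrMr// mul1r !mxE.
have := leq_card _ code_inj; rewrite card_ffun !card_ord -(ler_nat R) natrX.
move=> /le_trans; apply.
have x0 : 0 <= 2 * B * m%:R / d by rewrite divr_ge0 ?mulr_ge0 ?(ltW d0)// ltW.
by rewrite ler_pXn2r ?nnegrE ?addr_ge0// -natr1 lerD2r truncn_le.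
Qed.

(** If [x > y], Bernoulli's inequality makes [(x / y) ^ k] grow at least linearly in [k], whereas
    the hypothesis bounds it by [C]. *)
Lemma le_of_geometric_growth (C x y : R) : 0 < y ->
  (forall k, x ^+ k <= C * y ^+ k) -> x <= y.
Proof.
move=> y0 xy; rewrite leNgt; apply/negP => yx.
pose h := x / y - 1.
have h0 : 0 < h by rewrite subr_gt0 ltr_pdivlMr ?mul1r.
have bern k : 1 + k%:R * h <= (x / y) ^+ k.
  elim: k => [|k ih]; first by rewrite mul0r addr0 expr0.
  have -> : x / y = 1 + h by rewrite /h; lra.
  rewrite exprS -natr1; move: ih; have -> : x / y = 1 + h by rewrite /h; lra.
  have : 0 <= k%:R :> R by []. nra.
have bdd k : 1 + k%:R * h <= C.
  by apply: le_trans (bern k) _; rewrite expr_div_n ler_pdivrMr ?exprn_gt0.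
have C0 : 0 <= C by have := bdd 0; lra.
have := bdd (Num.bound (C / h)).
have : C / h < (Num.bound (C / h))%:R by apply: archi_boundP; rewrite divr_ge0// ltW.
rewrite ltr_pdivrMr//; lra.
Qed.

(* Placing a copy of the family, shrunk by the factor q, around each of its
   points and iterating k times gives N ^ k points whose separation decays
   like q ^ k; compare with the crude grid bound and let k tend to infinity. *)
Lemma card_separated (N : nat) (x : 'I_N -> 'rV[R]_m) (C eps : R) :
  0 <= C -> 0 < eps -> (forall i, enorm m (x i) <= C) ->
  (forall i j, i != j -> eps <= enorm m (x i - x j)) ->
  N%:R <= (2 * C / eps + 1) ^+ m.
Proof.
move=> C0 eps0 xC xsep.
(* These values make the iteration self-similar: [C + q * rad = rad], so the shrunk copies stay in
   the ball of radius [rad], and each has radius [q * rad = eps / 2], half the separation. Moreover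
   [1 / q = 2 * C / eps + 1] is the target base. *)
pose rad := C + eps / 2; pose q := (eps / 2) / rad.
have rad0 : 0 < rad by rewrite /rad; lra.
have q0 : 0 < q by rewrite divr_gt0//; lra.
have radq : rad * q = eps / 2 by rewrite /q mulrC divfK// gt_eqF.
pose pt := foldr (fun i (y : 'rV[R]_m) => x i + q *: y) 0.
(* The gap [rad * q ^ size s] matters: for words with different heads,
   [eps - 2 * q * (rad - rad * Q)] equals [2 * rad * q * Q], which is the separation claimed
   next. *)
have pt_le s : enorm m (pt s) <= rad - rad * q ^+ size s.
  elim: s => [|i s ih] /=; first by rewrite enorm0 expr0 mulr1 subrr.
  apply: le_trans (ler_enormD _ _) _; rewrite enormZ gtr0_norm// exprS.
  have := xC i; have : q * enorm m (pt s) <= q * (rad - rad * q ^+ size s) by rewrite ler_pM2l.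
  move: radq; rewrite /rad; nra.
have pt_sep s u : size s = size u -> s != u ->
    2 * rad * q ^+ size s <= enorm m (pt s - pt u).
  elim: s u => [|i s ih] [|j u]//= [su]; rewrite eqseq_cons negb_and.
  have [->/= sNu|ij _] := eqVneq i j.
    rewrite opprD addrACA subrr add0r -scalerBr enormZ gtr0_norm// exprS.
    by rewrite mulrCA ler_pM2l// ih.
  have := xsep _ _ ij.
  have -> : x i - x j = (x i + q *: pt s - (x j + q *: pt u)) + q *: (pt u - pt s).
    by apply/rowP => l; rewrite !mxE; ring.
  move=> /le_trans/(_ (ler_enormD _ _)); rewrite enormZ gtr0_norm//.
  have := ler_enormB (pt u) (pt s); have := pt_le s; have := pt_le u.
  rewrite -su exprS; set Q := q ^+ _; set e := enorm m (pt u - pt s) => b1 b2 b3.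
  have : q * e <= q * (2 * (rad - rad * Q)) by rewrite ler_pM2l//; lra.
  nra.
(* The grid bound for words of length [k] has base [m * q^-k + 1 <= (m + 1) * q^-k]; its [m]-th
   power gives the constant [(m + 1) ^ m]. *)
apply: (@le_of_geometric_growth ((m%:R + 1) ^+ m)).
  by rewrite exprn_gt0// ltr_wpDl// divr_ge0// ?mulr_ge0// ltW.
move=> k.
have qk0 : 0 < q ^+ k by rewrite exprn_gt0.
have := @card_separated_grid (k.-tuple 'I_N : finType) (fun t => pt t) rad (2 * rad * q ^+ k).
rewrite card_tuple card_ord natrX => /(_ _ _ _ _)/le_trans; apply.
- by rewrite !mulr_gt0.
- exact: ltW.
- move=> t; apply: le_trans (pt_le _) _; by rewrite gerBl ltW// mulr_gt0// exprn_gt0.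
- move=> t u tu; have := pt_sep t u; rewrite !size_tuple; exact.
rewrite -exprM mulnC exprM -exprMn.
have -> : 2 * C / eps + 1 = q^-1.
  by rewrite /q /rad; field; rewrite ?gt_eqF//; lra.
have -> : 2 * rad * m%:R / (2 * rad * q ^+ k) = m%:R * q^-1 ^+ k.
  by rewrite exprVn; field; rewrite !gt_eqF.
have q1 : 1 <= q^-1 ^+ k.
  by rewrite exprn_ege1// invf_ge1// /q ler_pdivrMr// /rad; lra.
have m0 : 0 <= m%:R :> R by [].
set Q := q^-1 ^+ k in q1 *; have Q0 : 0 <= m%:R * Q by rewrite mulr_ge0//; lra.
by rewrite ler_pXn2r ?nnegrE ?mulr_ge0//; lra.
Qed.

(** A separated family of maximal cardinality is a cover, since an uncovered point could be adjoined
    to it. The maximum exists by the bound of [card_separated]. The centres lie in the ball, so they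
    can serve as initial values. *)
Lemma ball_cover (C eps : R) : 0 <= C -> 0 < eps ->
  exists N : nat, exists c : nat -> 'rV[R]_m,
    [/\ N%:R <= (2 * C / eps + 1) ^+ m,
        forall i, (i < N)%N -> enorm m (c i) <= C &
        forall Y, enorm m Y <= C -> exists i, (i < N)%N /\ enorm m (Y - c i) <= eps].
Proof.
move=> C0 eps0.
pose packing N (c : nat -> 'rV[R]_m) := (forall i, (i < N)%N -> enorm m (c i) <= C) /\
  (forall i j, (i < N)%N -> (j < N)%N -> i != j -> eps <= enorm m (c i - c j)).
have packing_card N c : packing N c -> N%:R <= (2 * C / eps + 1) ^+ m.
  move=> [cC csep]; apply: (@card_separated N (fun i => c i)) => // i.
    exact: cC.
  by move=> j ij; apply: csep.
pose P N := `[< exists c, packing N c >].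
have exP : exists N, P N by exists 0%N; apply/asboolP; exists (fun=> 0); split.
have ubP N : P N -> (N <= Num.truncn ((2 * C / eps + 1) ^+ m))%N.
  move=> /asboolP[c /packing_card cN].
  by rewrite truncn_ge_nat// (le_trans _ cN).
case: (ex_maxnP exP ubP) => N /asboolP[c cP] Nmax.
exists N, c; split; [exact: packing_card cP|by case: cP|].
move=> Y YC; apply: contrapT => noc; case: cP => cC csep.
have far i : (i < N)%N -> eps <= enorm m (Y - c i).
  by move=> iN; rewrite leNgt; apply/negP => /ltW ?; apply: noc; exists i.
suff /Nmax : P N.+1 by rewrite ltnn.
apply/asboolP; exists (fun i => if i == N then Y else c i); split.
  by move=> i; rewrite ltnS leq_eqVlt; case: eqVneq => //= _; exact: cC.
move=> i j; rewrite !ltnS (leq_eqVlt i N) (leq_eqVlt j N).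
have [->|_] := eqVneq i N; have [->|_] := eqVneq j N; rewrite ?orTb ?orFb.
- by [].
- by move=> _ jN _; exact: far.
- by move=> iN _ _; rewrite enorm_distC; exact: far.
- exact: csep.
Qed.

End BallCovering.

(** * Closed form of the constant [Lmax] *)

Lemma Rintegral_expRN (R : realType) (c x : R) : 0 < c -> 0 <= x ->
  Rintegral lebesgue_measure (cinterval 0 x) (fun s => expR (- (s * c))) =
  (1 - expR (- (x * c))) / c.
Proof.
move=> c_gt0; have -> : cinterval 0 x = `[0, x]%classic.
  by apply/seteqP; split => s /=; rewrite in_itv.
(* The fundamental theorem of calculus is applied on a nondegenerate interval, so [x = 0] is treated
   apart. *)
rewrite le_eqVlt => /predU1P[<-|x0].
  by rewrite set_itv1 Rintegral_set1 mul0r oppr0 expR0 subrr mul0r.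
pose P (s : R) := - (expR (- (s * c)) / c).
have dP (s : R) : is_derive s 1 P (expR (- (s * c))).
  rewrite /P; apply: is_derive_eq.
  by rewrite /GRing.scale /=; field; rewrite gt_eqF.
rewrite /Rintegral (@continuous_FTC2 R _ P)//=.
- by rewrite /P mul0r oppr0 expR0; field; rewrite gt_eqF.
- apply: continuous_subspaceT => s.
  apply: (continuous_comp (f := fun s : R => - (s * c)) (g := expR)); last exact: continuous_expR.
  by apply: continuousN; apply: mulrr_continuous.
- have derP s : derivable P s 1 by exact: (@ex_derive _ _ _ _ _ _ _ (dP s)).
  have cP : continuous P.
    by move=> s; apply/differentiable_continuous/derivable1_diffP; exact: derP.
  split; first by move=> s _; exact: derP.
    by apply: cvg_at_right_filter; exact: cP.
  by apply: cvg_at_left_filter; exact: cP.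
- by move=> s _; rewrite derive1E (@derive_val _ _ _ _ _ _ _ (dP s)).
Qed.

(** Evaluating the integral turns the expression under the supremum into the nondecreasing function
    [h]. Gronwall measures time from [a0], [Lmax] from 0; since [a0 >= 0], the elapsed time [t] is
    at most [a0 + al], where the supremum is reached. *)
Lemma Lmax_ge (R : realType) (L a0 al t : R) : 0 <= a0 -> 0 <= t <= al ->
  let c := Num.sqrt (L ^+ 2 + 1) in
  expR (t * c) * (1 + c^-1) - c^-1 <= Lmax L a0 al.
Proof.
move=> a00 /andP[t0 tal] /=; rewrite /Lmax; set c := Num.sqrt _.
have c0 : 0 < c by rewrite sqrtr_gt0 ltr_wpDl// sqr_ge0.
pose h x := expR (x * c) * (1 + c^-1) - c^-1.
have hmono x y : x <= y -> h x <= h y.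
  by move=> xy; rewrite lerD2r ler_pM2r ?addr_gt0 ?invr_gt0// ler_expR ler_pM2r.
have hE x : cinterval a0 (a0 + al) x -> expR (x * c) *
   (1 + Rintegral lebesgue_measure (cinterval 0 x) (fun s => expR (- (s * c)))) = h x.
  move=> /= /andP[ax _]; rewrite Rintegral_expRN//; last exact: le_trans ax.
  by rewrite /h expRN; field; rewrite !gt_eqF// expR_gt0.
apply: (@le_trans _ _ (h (a0 + al))); first by apply: hmono; lra.
have top : cinterval a0 (a0 + al) (a0 + al) by rewrite /cinterval /=; lra.
apply: sup_ubound; last by exists (a0 + al) => //; exact: hE.
exists (h (a0 + al)) => _ [x Ix <-]; rewrite hE//; apply: hmono.
by move: Ix => /= /andP[].
Qed.

(** * Derivatives relative to an interval: continuity, and agreement with ordinary derivatives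
    inside *)

Section DerivOn.
Context {R : realType}.
Implicit Types (I : set R) (h g : R -> R).

Lemma deriv_on_continuous I h g : deriv_on I h g -> {within I, continuous h}.
Proof.
move=> hg; apply/subspace_continuousP => x Ix.
have := hg _ Ix => /cvgrPdist_lt/= /(_ 1 ltr01).
rewrite near_withinE => nq.
apply/cvgrPdist_lt => /= e e0.
rewrite near_withinE.
(* Near [x] the difference quotient is within 1 of [g x], so [K] is a local Lipschitz constant at
   [x]. *)
pose K := `|g x| + 1.
have K0 : 0 < K by rewrite ltr_wpDl.
have [d /= d0 hd] := (@nbhs_ballP _ _ _ _).1 nq.
apply/nbhs_ballP; exists (Num.min d (e / K)) => /=.
  by rewrite lt_min d0 divr_gt0.
move=> y; rewrite /ball/= lt_min => /andP[yd ye] Iy.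
have [->|yx] := eqVneq y x; first by rewrite subrr normr0.
have ball0 : ball 0 d (y - x) by rewrite /ball/= sub0r opprB.
have hyp : y - x != 0 /\ I (x + (y - x)) by rewrite subr_eq0 yx addrC subrK.
have := hd (y - x) ball0 hyp; rewrite [x + _]addrC subrK.
set q := _ * (h y - h x) => gq.
have -> : h x - h y = (x - y) * q.
  rewrite /q -[x - y]opprB mulrA mulNr divff ?subr_eq0//; ring.
rewrite normrM.
have qK : `|q| < K.
  rewrite /K; have := ler_normD (q - g x) (g x); rewrite subrK distrC; lra.
apply: (@le_lt_trans _ _ (`|x - y| * K)); first by rewrite ler_wpM2l// ltW.
by rewrite -ltr_pdivlMr.
Qed.

Lemma deriv_on_is_derive lo hi h g : deriv_on (cinterval lo hi) h g ->
  forall x, lo < x < hi -> is_derive x 1 h (g x).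
Proof.
move=> hg x /andP[lx xh].
have Ix : cinterval lo hi x by rewrite /cinterval/= !ltW.
suff cv : (fun t => t^-1 *: (h (t *: 1 + x) - h x)) @ (0 : R)^' --> g x.
  by apply: DeriveDef; [apply/cvg_ex; exists (g x)|exact: cvg_lim cv].
apply/cvgrPdist_lt => /= e e0.
have := hg _ Ix => /cvgrPdist_lt/= /(_ e e0); rewrite near_withinE => nq.
rewrite near_withinE.
have nI : \forall t \near (0 : R), cinterval lo hi (x + t).
  apply/nbhs_ballP; exists (Num.min (x - lo) (hi - x)) => /=.
    by rewrite lt_min !subr_gt0 lx.
  move=> t; rewrite /ball/= sub0r normrN lt_min !ltr_norml /cinterval/=; lra.
near=> t => t0.
have -> : t *: (1 : R) + x = x + t by rewrite /GRing.scale /= mulr1 addrC.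
have nqt : t != 0 /\ cinterval lo hi (x + t) -> `|g x - t^-1 * (h (x + t) - h x)| < e.
  by near: t; exact: nq.
by apply: nqt; split => //; near: t; exact: nI.
Unshelve. all: by end_near. Qed.

End DerivOn.

(** * Gronwall's inequality for the first-order system *)

Section SystemGronwall.
Context {R : realType}.
Implicit Types (I : set R) (z : nat -> R -> R).

Lemma deriv_onB I (h1 g1 h2 g2 : R -> R) : deriv_on I h1 g1 -> deriv_on I h2 g2 ->
  deriv_on I (fun x => h1 x - h2 x) (fun x => g1 x - g2 x).
Proof.
move=> d1 d2 x Ix; apply: cvg_trans (cvgB (d1 _ Ix) (d2 _ Ix)).
by apply: near_eq_cvg; near=> t; rewrite /= !fctE; ring.
Unshelve. all: by end_near. Qed.

Lemma Yvec_enormE m z x :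
  enorm m (Yvec z x) = Num.sqrt (\sum_(i < m) z i x ^+ 2).
Proof. by congr Num.sqrt; apply: eq_bigr => i _; rewrite mxE. Qed.

(** The left side is half the derivative of [|Z|^2], as [Z'] is [Z] shifted by one index. With
    [s = |Z|] and [c = sqrt (L^2 + 1)], [|Z'|^2 <= s^2 + (L * s + e)^2 <= (c * s + e)^2] because
    [L <= c]; Cauchy-Schwarz concludes. *)
Lemma shifted_inner_prod_le m z x (L e : R) : (0 < m)%N -> 0 <= L -> 0 <= e ->
  `|z m x| <= L * enorm m (Yvec z x) + e ->
  \sum_(i < m) z i x * z i.+1 x <=
  enorm m (Yvec z x) * (Num.sqrt (L ^+ 2 + 1) * enorm m (Yvec z x) + e).
Proof.
case: m => // m _ L0 e0; set s := enorm _ _; set c := Num.sqrt _ => zm.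
have s0 : 0 <= s by exact: enorm_ge0.
apply: le_trans (cauchy_schwarz (fun i : 'I_m.+1 => z i x) (fun i => z i.+1 x)) _.
rewrite -Yvec_enormE -/s ler_wpM2l//.
have c0 : 0 <= c by exact: sqrtr_ge0.
have c2 : c ^+ 2 = L ^+ 2 + 1 by rewrite sqr_sqrtr// addr_ge0// sqr_ge0.
have Lc : L <= c by rewrite -(@ler_pXn2r _ 2) ?nnegrE// c2 lerDl.
have cs0 : 0 <= c * s + e by rewrite addr_ge0// mulr_ge0.
rewrite -(ger0_norm cs0) -sqrtr_sqr ler_sqrt ?sqr_ge0//.
have s2 : s ^+ 2 = z 0%N x ^+ 2 + \sum_(i < m) z i.+1 x ^+ 2.
  rewrite sqr_enorm big_ord_recl mxE; congr (_ + _).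
  by apply: eq_bigr => i _; rewrite mxE.
rewrite big_ord_recr /=.
have : z m.+1 x ^+ 2 <= (L * s + e) ^+ 2.
  by rewrite -(real_normK (num_real (z m.+1 x))) ler_pXn2r ?nnegrE ?addr_ge0// mulr_ge0.
have := sqr_ge0 (z 0%N x).
have -> : (c * s + e) ^+ 2 = (L ^+ 2 + 1) * s ^+ 2 + 2 * (c * s * e) + e ^+ 2.
  by rewrite -c2; ring.
have : L * (s * e) <= c * (s * e) by rewrite ler_wpM2r// mulr_ge0.
nra.
Qed.

Lemma system_gronwall m z (a0 al L e : R) :
  (0 < m)%N -> 0 <= L -> 0 <= e ->
  (forall k, (k < m)%N -> deriv_on (cinterval a0 (a0 + al)) (z k) (z k.+1)) ->
  (forall x, cinterval a0 (a0 + al) x -> `|z m x| <= L * enorm m (Yvec z x) + e) ->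
  enorm m (Yvec z a0) <= e ->
  let c := Num.sqrt (L ^+ 2 + 1) in
  forall x, cinterval a0 (a0 + al) x ->
    enorm m (Yvec z x) <= e * (expR ((x - a0) * c) * (1 + c^-1) - c^-1).
Proof.
move=> m0 L0 e0 dz zm za0 c x Ix.
have c0 : 0 < c by rewrite sqrtr_gt0 ltr_wpDl// sqr_ge0.
set rhs := e * _.
suff bound eta : 0 < eta -> enorm m (Yvec z x) <= rhs + eta * expR ((x - a0) * c).
  apply/ler_addgt0Pr => r r0.
  have := bound (r / expR ((x - a0) * c)).
  by rewrite divfK ?gt_eqF ?expR_gt0//; apply; rewrite divr_gt0// expR_gt0.
move=> eta0.
pose E y := \sum_(i < m) z i y ^+ 2.
(* eta keeps the square root differentiable where the energy vanishes. *)
pose u y := Num.sqrt (E y + eta ^+ 2).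
have E0 y : 0 <= E y by apply: sumr_ge0 => i _; exact: sqr_ge0.
have Eeta y : 0 < E y + eta ^+ 2 by rewrite ltr_wpDl// exprn_gt0.
have u0 y : 0 < u y by rewrite sqrtr_gt0.
have su y : enorm m (Yvec z y) <= u y.
  by rewrite Yvec_enormE ler_sqrt ?(ltW (Eeta y))// lerDl sqr_ge0.
(* Adding [e / c] turns [u' <= c * u + e] into the homogeneous [(u + e / c)' <= c * (u + e / c)], so
   the integrating factor makes [G] nonincreasing. *)
pose G y := (u y + e / c) * expR (- ((y - a0) * c)).
have dG y : a0 < y < a0 + al -> is_derive y 1 G
  (((2 * u y)^-1 * (\sum_(i < m) 2 * (z i y * z i.+1 y)) - c * (u y + e / c))
     * expR (- ((y - a0) * c))).
  move=> yI.
  have dE : is_derive y 1 (fun y => E y + eta ^+ 2) (\sum_(i < m) 2 * (z i y * z i.+1 y)).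
    have -> : (fun y => E y + eta ^+ 2) = \sum_(i < m) (z i) ^+ 2 + cst (eta ^+ 2).
      by rewrite fct_sumE; apply/funext.
    have dzi (i : 'I_m) := deriv_on_is_derive (dz i (ltn_ord i)) yI.
    apply: is_derive_eq; rewrite addr0; apply: eq_bigr => i _.
    by rewrite /GRing.scale /=; ring.
  have du : is_derive y 1 u ((2 * u y)^-1 * (\sum_(i < m) 2 * (z i y * z i.+1 y))).
    by apply: (is_derive1_comp (g := fun y => E y + eta ^+ 2)); exact: is_derive1_sqrt.
  rewrite /G; apply: is_derive_eq.
  by rewrite /GRing.scale /=; ring.
(* Derivatives of [G] are available inside the interval; continuity up to the endpoints lets
   monotonicity reach [a0]. *)
have cG : {within `[a0, a0 + al], continuous G}.
  have -> : [set` `[a0, a0 + al]] = cinterval a0 (a0 + al).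
    by apply/seteqP; split => y /=; rewrite in_itv.
  apply/subspace_continuousP => y Iy.
  have cz (i : 'I_m) : z i t @[t --> within (cinterval a0 (a0 + al)) (nbhs y)] --> z i y.
    exact: (subspace_continuousP _ _).1 (deriv_on_continuous (dz i (ltn_ord i))) _ Iy.
  have cE : E t @[t --> within (cinterval a0 (a0 + al)) (nbhs y)] --> E y.
    by apply: cvg_big => [|i _]; [exact: add_continuous|apply: cvgM; exact: cz].
  apply: cvgM.
    apply: cvgD; last exact: cvg_cst.
    apply: (continuous_cvg _ (h := Num.sqrt)); first exact: sqrt_continuous.
    by apply: cvgD => //; exact: cvg_cst.
  apply: (continuous_cvg _ (h := expR)); first exact: continuous_expR.
  apply: cvg_within_filter.
  apply: cvgN; apply: cvgMl; apply: cvgB; [exact: cvg_id|exact: cvg_cst].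
have Gdecr : G x <= G a0.
  apply: (ler0_derive1_le_cc _ _ cG); rewrite ?in_itv/=; first last.
  - by move: Ix => /= /andP[].
  - by move: Ix => /= /andP[? ?]; rewrite lexx /=; lra.
  - exact: Ix.
  - move=> y; rewrite in_itv/= => yI; have dGy := dG _ yI.
    rewrite derive1E derive_val pmulr_lle0 ?expR_gt0//.
    have Iy : cinterval a0 (a0 + al) y by move: yI => /andP[? ?]; rewrite /cinterval/= !ltW.
    have := shifted_inner_prod_le m0 L0 e0 (zm _ Iy).
    rewrite -mulr_sumr; set S := \sum_(i < m) _; rewrite -/c.
    (* The inner-product bound is in terms of [s = |Z|], the derivative of [G] in terms of the
       regularised [v >= s]; the bound [s * (c * s + e)] increases when [s] is replaced by [v]. *)
    have := su y; have := enorm_ge0 (Yvec z y : 'rV_m); have := u0 y.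
    set s := enorm _ _; set v := u y => v0 s0 sv Ss.
    have -> : (2 * v)^-1 * (2 * S) - c * (v + e / c) = (S - v * (c * v + e)) / v.
      by field; rewrite !gt_eqF.
    rewrite pmulr_lle0 ?invr_gt0// subr_le0; apply: le_trans Ss _.
    have cs0 : 0 <= c * s + e by rewrite addr_ge0// mulr_ge0// ltW.
    by apply: ler_pM => //; rewrite lerD2r ler_pM2l.
  - by move=> y; rewrite in_itv/= => yI; have := dG _ yI; case.
have ua0 : u a0 <= e + eta.
  rewrite -[e + eta]ger0_norm ?addr_ge0// ?(ltW eta0)// -sqrtr_sqr ler_sqrt ?sqr_ge0//.
  have -> : E a0 = enorm m (Yvec z a0) ^+ 2 by rewrite Yvec_enormE sqr_sqrtr// E0.
  have := enorm_ge0 (Yvec z a0 : 'rV_m); nra.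
apply: le_trans (su x) _.
move: Gdecr; rewrite /G subrr mul0r oppr0 expR0 mulr1 expRN.
rewrite ler_pdivrMr ?expR_gt0// => Gx.
have X0 := expR_gt0 ((x - a0) * c).
rewrite /rhs; move: Gx; set X := expR _ in X0 *; set ci := c^-1; nra.
Qed.

End SystemGronwall.

Lemma solution_dist (R : realType) (m : nat) (a0 a b C0 L al e : R)
    (f g : R * 'rV[R]_m -> R) (Y0 Z0 : 'rV[R]_m) (ys zs : nat -> R -> R) :
  (0 < m)%N -> 0 <= a0 -> 0 <= L -> 0 <= e ->
  (forall x Y Yt, Gammabar m a0 a b C0 (x, Y) -> Gammabar m a0 a b C0 (x, Yt) ->
     `|f (x, Y) - f (x, Yt)| <= L * enorm m (Y - Yt)) ->
  (forall p, Gammabar m a0 a b C0 p -> `|f p - g p| <= e) ->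
  enorm m (Y0 - Z0) <= e ->
  is_solution m a0 a b C0 al f Y0 ys -> is_solution m a0 a b C0 al g Z0 zs ->
  forall k x, (k < m)%N -> cinterval a0 (a0 + al) x ->
    `|ys k x - zs k x| <= e * Lmax L a0 al.
Proof.
move=> m0 a00 L0 e0 fL fg YZ [dy [ym [ya yG]]] [dz [zm [za zG]]] k x km Ix.
pose w i t := ys i t - zs i t.
have wE t : Yvec w t = Yvec ys t - Yvec zs t :> 'rV_m by apply/rowP => i; rewrite !mxE.
apply: (@le_trans _ _ (enorm m (Yvec w x))).
  by have := ler_coord_enorm (Yvec w x) (Ordinal km); rewrite mxE.
have t_al : 0 <= x - a0 <= al by move: Ix => /= /andP[? ?]; lra.
apply: le_trans (ler_wpM2l e0 (Lmax_ge L a00 t_al)).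
apply: (system_gronwall m0 L0 e0 _ _ _ Ix).
- by move=> i im; apply: deriv_onB; [exact: dy|exact: dz].
(* Insert [f (t, Yvec zs t)]: the Lipschitz condition on [f] controls one difference, the distance
   from [f] to [g] the other. *)
- move=> t It; rewrite wE /w ym// zm//.
  have := fL _ _ _ (yG t It) (zG t It); have := fg _ (zG t It).
  have := ler_normD (f (t, Yvec ys t) - f (t, Yvec zs t))
                    (f (t, Yvec zs t) - g (t, Yvec zs t)).
  rewrite addrA subrK; lra.
- by rewrite wE ya za.
Qed.

(** * Covering numbers as minima *)

Section CoveringNumber.
Context {R : realType} {T : Type}.
Implicit Types (D : set T) (A : set (T -> R)) (c : nat -> T -> R).

Lemma supdist_le D (f g : T -> R) (r : R) :
  (supdist D f g <= r%:E)%E <-> forall x, D x -> `|f x - g x| <= r.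
Proof.
split=> [fg x Dx|fg].
  by rewrite -lee_fin; apply: le_trans fg; apply: ereal_sup_ubound; exists x.
by apply: ge_ereal_sup => _ [x Dx <-]; rewrite lee_fin fg.
Qed.

Lemma covnum_le D (delta : R) A (n : nat) c :
  (forall i, (i < n)%N -> A (c i)) ->
  (forall t, A t -> exists i, (i < n)%N /\ forall x, D x -> `|t x - c i x| <= delta) ->
  (covnum D delta A <= (n%:R)%:E)%E.
Proof.
move=> cA cover; apply: ereal_inf_lbound; exists n => //; exists c; split => // t.
by move=> /cover[i [iN tc]]; exists i; split => //; exact/supdist_le.
Qed.

(** The admissible cardinalities are natural numbers, so if there are any, a least one exists and an
    optimal cover can be named. *)
Lemma covnum_attained D (delta : R) A : covnum D delta A = +oo%E \/
  exists n c, [/\ covnum D delta A = (n%:R)%:E, forall i, (i < n)%N -> A (c i) &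
    forall t, A t -> exists i, (i < n)%N /\ forall x, D x -> `|t x - c i x| <= delta].
Proof.
rewrite /covnum; set S := [set n : nat | _].
have [S0|/set0P[n0 Sn0]] := eqVneq S set0.
  by left; rewrite S0 image_set0 ereal_inf0.
right; have exS : exists n, `[< S n >] by exists n0; apply/asboolP.
case: (ex_minnP exS) => n /asboolP Sn nmin; have [c [cA cover]] := Sn.
exists n, c; split => //.
  apply/eqP; rewrite eq_le; apply/andP; split.
    by apply: ereal_inf_lbound; exists n.
  by apply: le_ereal_inf_tmp => _ [k Sk <-]; rewrite lee_fin ler_nat nmin//; apply/asboolP.
by move=> t /cover[i [iN /supdist_le tc]]; exists i.
Qed.

End CoveringNumber.

(** * The product cover and its cardinality *)

Theorem theorem2p1 (R : realType) (m : nat) (a0 a b C0 L M : R)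
    (F : set (R * 'rV[R]_m -> R)) :
  (1 <= m)%N -> 0 <= a0 -> 0 < a -> 0 < b -> 0 < C0 -> 0 <= L -> 0 < M ->
  (forall f, F f ->
     {within Gammabar m a0 a b C0, continuous f} /\
     (forall p, Gammabar m a0 a b C0 p -> `|f p| <= M) /\
     (forall x Y Yt, Gammabar m a0 a b C0 (x, Y) -> Gammabar m a0 a b C0 (x, Yt) ->
        `|f (x, Y) - f (x, Yt)| <= L * enorm m (Y - Yt))) ->
  (forall f (Y0 : 'rV[R]_m), F f -> enorm m Y0 <= C0 ->
     exists ys, is_solution m a0 a b C0 (Num.min a (b / M)) f Y0 ys) ->
  forall delta : R, 0 < delta -> forall k : nat, (k < m)%N ->
  let al := Num.min a (b / M) in
  let Lm := Lmax L a0 al in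
  (lne (covnum (cinterval a0 (a0 + al)) delta (Ycls m a0 a b C0 al F k))
   <= lne (covnum (Gammabar m a0 a b C0) (delta / Lm) F)
      + (m%:R * ln (2 * C0 * Lm / delta + 1))%:E)%E.
Proof.

move=> m0 a00 a_gt0 b0 C00 L0 M0 FH Fsol delta d0 k km; lazy zeta.
set al := Num.min a (b / M) in Fsol *; set Lm := Lmax L a0 al.
have al0 : 0 < al by rewrite lt_min a_gt0 divr_gt0.
(* Elapsed time 0 in [Lmax_ge] gives [1 <= Lm]. *)
have Lm0 : 0 < Lm.
  have : 0 <= (0 : R) <= al by apply/andP; split; last exact: ltW.
  move=> /(Lmax_ge L a00)/=; rewrite mul0r expR0 mul1r addrK; exact: lt_le_trans ltr01.
pose e := delta / Lm; have e0 : 0 < e by rewrite divr_gt0.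
rewrite -/e; have -> : 2 * C0 * Lm / delta + 1 = 2 * C0 / e + 1.
  by rewrite /e; field; rewrite !gt_eqF.
set lam := 2 * C0 / e + 1.
have lam0 : 0 < lam.
  by apply: ltr_wpDl => //; apply: divr_ge0; [lra|exact: ltW].
have [->|[n [c [-> cF cover]]]] := covnum_attained (Gammabar m a0 a b C0) e F.
  by rewrite /= addye// leey.
have [N [y [Nlam yC ycover]]] := ball_cover m0 (ltW C00) e0.
pose good i j ys := is_solution m a0 a b C0 al (c i) (y j) ys.
(* Choose one solution for each pair of a right-hand side and an initial value from the two covers;
   indices out of range get the zero function. *)
have [sol solP] : exists sol : nat -> nat -> nat -> R -> R,
    forall i j, (i < n)%N -> (j < N)%N -> good i j (sol i j).
  have /choice[s sP] : forall ij : nat * nat, exists ys,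
      (ij.1 < n)%N -> (ij.2 < N)%N -> good ij.1 ij.2 ys.
    move=> [i j] /=; have [iN|iN] := boolP (i < n)%N; last by exists (fun _ _ => 0).
    have [jN|jN] := boolP (j < N)%N; last by exists (fun _ _ => 0).
    by have [ys ?] := Fsol _ _ (cF _ iN) (yC _ jN); exists ys.
  by exists (fun i j => s (i, j)) => i j; exact: (sP (i, j)).
have covY : (covnum (cinterval a0 (a0 + al)) delta (Ycls m a0 a b C0 al F k)
    <= ((n * N)%N%:R)%:E)%E.
  (* The pair [(i, j)] is encoded as [i * N + j] and recovered by quotient and remainder modulo
     [N]. *)
  apply: (@covnum_le _ _ _ _ _ _ (fun l => sol (l %/ N)%N (l %% N)%N k)).
    move=> l lnN; have N0 : (0 < N)%N by case: N lnN {Nlam yC ycover solP} => //; rewrite muln0.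
    have ln : (l %/ N < n)%N by rewrite ltn_divLR.
    have lN : (l %% N < N)%N by rewrite ltn_mod.
    exists (c (l %/ N)%N), (y (l %% N)%N), (sol (l %/ N)%N (l %% N)%N).
    by split; [exact: cF|split; [exact: yC|split; [exact: solP|]]].
  move=> _ [f [Y0 [ys [Ff [Y0C [ysS ->]]]]]].
  have [i [iN fc]] := cover _ Ff; have [j [jN Yy]] := ycover _ Y0C.
  exists (i * N + j)%N; split.
    apply: (@leq_trans (i.+1 * N)); last by rewrite leq_mul2r iN orbT.
    by rewrite mulSn addnC ltn_add2r.
  have N0 : (0 < N)%N by apply: leq_ltn_trans jN.
  move=> x Ix; rewrite divnMDl// (divn_small jN) addn0 modnMDl (modn_small jN).
  have -> : delta = e * Lm by rewrite /e divfK// gt_eqF.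
  have [_ [_ fL]] := FH _ Ff.
  exact: (solution_dist m0 a00 L0 (ltW e0) fL fc Yy ysS (solP _ _ iN jN) km Ix).
(* If [n = 0], both covering numbers are 0 and both logarithms are [-oo]. *)
have [n0|n0] := posnP n.
  by rewrite n0 mul0n in covY *; rewrite !le0_lneNy// lee_fin.
(* The ball contains the origin, so its cover is nonempty and the real logarithm of [n * N]
   splits. *)
have N0 : (0 < N)%N.
  have := ycover 0; rewrite enorm0 => /(_ (ltW C00))[j [jN _]].
  exact: leq_ltn_trans jN.
have nR : 0 < n%:R :> R by rewrite ltr0n.
have NR : 0 < N%:R :> R by rewrite ltr0n.
apply: (@le_trans _ _ (lne ((n * N)%N%:R)%:E)).
  rewrite lee_lne// in_itv/= leey andbT ?lee_fin//.
  by apply: le_ereal_inf_tmp => _ [l _ <-]; rewrite lee_fin.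
rewrite !lne_EFin ?ltr0n ?muln_gt0 ?n0// -EFinD lee_fin natrM lnM ?posrE// lerD2l.
by rewrite mulr_natl -lnXn// ler_ln ?posrE// exprn_gt0.
Qed.
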